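(* There is a constant $C<\infty$ such that for all $d\ge 4$, $$\sup_{0\le i\le d-1}P\left(\inf_{0\le j\le d-1}\left\{T^{(i,j)}_{d-1}\right\}<\infty\right)\le\frac{C}{d},$$ where $T^{(i,j)}_{d-1}=\inf\{n\ge 1:\ \hat X_{d-1,n}=e_{d-1,j}-e_{d-1,i}\}$ for $0\le i,j\le d-1$, and $\{\hat X_{d-1,n}\}_{n\ge0}$ is the $(d-1)$-dimensional random walk, started at $0$, of successive coordinate differences of a $d$-dimensional simple random walk.
   Context: Let $\{X_{d,n}\}_{n\ge 0}$ be a $d$-dimensional simple random walk starting at $0$ (each step goes to one of the $2d$ nearest neighbors with equal probability), with coordinates $X_{d,n}^1,\dots,X_{d,n}^d$. Define $$\hat X_{d-1,n}=\left(X_{d,n}^1-X_{d,n}^2,\ X_{d,n}^2-X_{d,n}^3,\ \dots,\ X_{d,n}^{d-1}-X_{d,n}^{d}\right)\in\mathbb{Z}^{d-1},$$ which is a random walk on $\mathbb{Z}^{d-1}$ starting at $0$. Here $e_{d-1,1},\dots,e_{d-1,d-1}$ is the standard basis of $\mathbb{Z}^{d-1}$ and $e_{d-1,0}=0$. Convention: $\inf\emptyset=\infty$. *)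

(* Defs.v *)
From HB Require Import structures.
From mathcomp Require Import all_boot all_order all_algebra finmap.
From mathcomp Require Import all_classical all_reals all_analysis.

Set Implicit Arguments.
Unset Strict Implicit.
Unset Printing Implicit Defensive.

Import Order.TTheory GRing.Theory Num.Theory.

Local Open Scope classical_set_scope.
Local Open Scope ring_scope.

(* V stands for a countable state space with the discrete sigma-algebra: every
   subset of V is an event, so all of them are tested. *)
Definition discrete_RV (disp : measure_display) (Omega : measurableType disp)
    (V : Type) (Y : Omega -> V) : Prop :=
  forall A : set V, measurable (Y @^-1` A).

Definition mutually_independent (R : realType) (disp : measure_display)
    (Omega : measurableType disp) (P : probability Omega R)
    (I : choiceType) (V : Type) (Y : I -> Omega -> V) : Prop :=
  forall (J : {fset I}) (A : I -> set V),
    P (\bigcap_(k in [set` J]) (Y k @^-1` A k)) =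
    (\prod_(k <- J) P (Y k @^-1` A k))%E.

(* The 2d nearest neighbours of 0 in Z^d: e_k for b = false, - e_k for
   b = true. *)
Definition unit_step (d : nat) (b : bool) (k : 'I_d) : 'rV[int]_d :=
  (-1) ^+ b *: delta_mx 0 k.

Definition increment (Omega : Type) (d : nat) (X : nat -> Omega -> 'rV[int]_d)
    (n : nat) (w : Omega) : 'rV[int]_d :=
  X n.+1 w - X n w.

(* The 2d prescribed probabilities add up to 1, so increments almost surely
   take no other value. *)
Definition simple_random_walk (R : realType) (disp : measure_display)
    (Omega : measurableType disp) (P : probability Omega R) (d : nat)
    (X : nat -> Omega -> 'rV[int]_d) : Prop :=
  [/\ forall w, X 0%N w = 0,
      forall n, discrete_RV (increment X n),
      forall n (b : bool) (k : 'I_d),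
        P [set w | increment X n w = unit_step b k] = ((2 * d)%:R^-1)%:E
    & mutually_independent P (increment X)].

Lemma succ_lt_of_pred (d : nat) (k : 'I_d.-1) : (k.+1 < d)%N.
Proof. by rewrite -ltn_predRL. Qed.

Definition coord_fst (d : nat) (k : 'I_d.-1) : 'I_d :=
  Ordinal (ltnW (succ_lt_of_pred k)).

Definition coord_snd (d : nat) (k : 'I_d.-1) : 'I_d :=
  Ordinal (succ_lt_of_pred k).

Definition coord_diff (d : nat) (x : 'rV[int]_d) : 'rV[int]_d.-1 :=
  \row_(k < d.-1) (x 0 (coord_fst k) - x 0 (coord_snd k)).

Definition diff_walk (Omega : Type) (d : nat) (X : nat -> Omega -> 'rV[int]_d)
    (n : nat) (w : Omega) : 'rV[int]_d.-1 :=
  coord_diff (X n w).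

(* The vectors e_{m,0} = 0 and e_{m,j} for 1 <= j <= m. Coordinates of row
   vectors are numbered from 0, so the entry 1 of e_{m,j} is at index j - 1. *)
Definition evec (m j : nat) : 'rV[int]_m :=
  \row_(k < m) (if k.+1 == j then 1 else 0).

(* T^{(i,j)}_{d-1}, with value +oo when the set of times is empty. *)
Definition hit_time (R : realType) (Omega : Type) (d : nat)
    (X : nat -> Omega -> 'rV[int]_d) (i j : 'I_d) (w : Omega) : \bar R :=
  ereal_inf [set (n%:R)%:E | n in
    [set n : nat | (1 <= n)%N /\
                   diff_walk X n w = evec d.-1 j - evec d.-1 i]].

(* Main.v *)
Require Import Defs.
From HB Require Import structures.
From mathcomp Require Import all_boot all_order all_algebra finmap.
From mathcomp Require Import all_classical all_reals all_analysis.
From mathcomp Require Import zify ring lra.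

Set Implicit Arguments.
Unset Strict Implicit.
Unset Printing Implicit Defensive.

Import Order.TTheory GRing.Theory Num.Theory.

Local Open Scope classical_set_scope.
Local Open Scope ring_scope.

(** The difference walk is at [e_j - e_i] exactly when the simple random walk is
    at [1_{k < j} - 1_{k < i} + c (1, ..., 1)] for some integer [c].  The
    coordinate sum of such a point is [j - i + c d] with [0 <= j < d], so it
    determines both [j] and [c]: for fixed [i], each integer is the coordinate sum
    of at most one target ([target_inj]).  After [n] steps the coordinate sum is
    between [-n] and [n], so at most [2 n + 1] targets are in reach, and the
    probability of sitting on a target at time [n] is at most [(2 n + 1) M_n],
    where [M_n] is the largest probability of a point at time [n]
    ([prob_target_le]).  It remains to see that the sum of [(2 n + 1) M_n] over
    [n >= 1] is [O(1 / d)], which follows from [M_n <= C / (d n^3)]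
    ([nwalk_decay]).  For [d < 8] the trivial bound [1 <= 8 / d] is enough.

    Two bounds on the number of [n]-step walks to a point give this estimate.
    For [n] fixed and [d] large, every step that is not forced by the end point
    must be undone by another one, so that there are at most
    [(n + 2)! d^(n / 2)] walks ([nwalk_fact]); as [M_n] is nonincreasing in [n],
    this settles [n <= d^6].
    For larger [n], condition on which coordinate moves at each step: the
    coordinates then perform independent one-dimensional walks, and one with
    [m] steps is at a given point with probability at most [(m + 1)^(-1/2)].
    With at least eight coordinates, the product of these probabilities is at most
    the eighth power of the largest one, thus at most [(m + 1)^(-4)] for one of the
    coordinates, and the mean of this over a binomial [m] of mean [n / d] is of
    order [(d / n)^4].  Summed over the [d] candidates for that coordinate, this
    gives the order [d^5 / n^4] ([nwalk_tail]). *)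

(** * Counting lattice walks: few steps *)

(** The number of [n]-step nearest-neighbour walks from [0] to [v]. *)
Fixpoint nwalk (d n : nat) (v : 'rV[int]_d) : nat :=
  if n is n'.+1 then
    (\sum_(k < d) (nwalk n' (v - unit_step false k) +
                   nwalk n' (v - unit_step true k)))%N
  else (v == 0).

Definition norm1 (d : nat) (v : 'rV[int]_d) : nat := (\sum_(k < d) `|v 0%R k|)%N.

(** The last step [unit_step b k] of a walk to [v] leads away from the origin:
    the position before it is closer to [0] than [v] is. *)
Definition outward (d : nat) (v : 'rV[int]_d) (b : bool) (k : 'I_d) : bool :=
  if b then v 0 k < 0 else 0 < v 0 k.

Lemma unit_stepE (d : nat) (b : bool) (k l : 'I_d) :
  unit_step b k 0 l = if l == k then (-1) ^+ b else 0.
Proof. by rewrite !mxE eqxx /=; case: eqP => _; rewrite ?mulr1 ?mulr0. Qed.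

Lemma norm1_sub_step (d : nat) (v : 'rV[int]_d) (b : bool) (k : 'I_d) :
  if outward v b k then norm1 v = (norm1 (v - unit_step b k)).+1
  else norm1 (v - unit_step b k) = (norm1 v).+1.
Proof.
have split_k u : norm1 u = (`|u 0%R k| + \sum_(l < d | l != k) `|u 0%R l|)%N.
  by rewrite /norm1 (bigD1 k).
have Erest : (\sum_(l < d | l != k) `|(v - unit_step b k)%R 0%R l| =
              \sum_(l < d | l != k) `|v 0%R l|)%N.
  by apply: eq_bigr => l /negPf lk; rewrite mxE [in X in _ + X]mxE unit_stepE lk subr0.
rewrite !split_k Erest mxE [in X in _ + X]mxE unit_stepE eqxx /outward.
by case: b {Erest} => /=; rewrite ?expr0 ?expr1; case: ltP => vk; lia.
Qed.

Lemma nwalk_far (d n : nat) (v : 'rV[int]_d) : (n < norm1 v)%N -> nwalk n v = 0%N.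
Proof.
elim: n v => [|n IH] v nv /=.
  case: eqP nv => // ->.
  by rewrite /norm1 big1 // => k _; rewrite mxE.
rewrite big1 // => k _; rewrite !IH //.
- by have := norm1_sub_step v true k; case: ifP => _; lia.
- by have := norm1_sub_step v false k; case: ifP => _; lia.
Qed.

Lemma sum_outward_le (d : nat) (v : 'rV[int]_d) :
  (\sum_(k < d) (outward v false k + outward v true k) <= norm1 v)%N.
Proof.
by apply: leq_sum => k _; rewrite /outward; case: (ltgtP (v 0 k) 0); lia.
Qed.

(** Let [m] be the [l1] norm of [v].  A last step that increases the norm can be
    chosen in at most [m <= n] ways; one that decreases the norm in [2 d] ways, but
    then the position before it is farther away, which leaves one fewer
    cancelling pair among the [n - 1] other steps, that is, one factor [d] less.
    The [.+1] in the hypothesis accounts for the parity of [n - m]. *)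
Lemma nwalk_fact (d n j : nat) (v : 'rV[int]_d) : (0 < d)%N ->
  (n <= (norm1 v + j.*2).+1)%N -> (nwalk n v <= n.+2`! * d ^ j)%N.
Proof.
move=> d_gt0; elim: n j v => [|n IH] j v nvj.
  apply: (@leq_trans 1%N); first by rewrite /=; case: eqP.
  by rewrite muln_gt0 fact_gt0 expn_gt0 d_gt0.
have [far|near] := ltnP n.+1 (norm1 v); first by rewrite nwalk_far.
pose K := n.+2`!.
(* For j = 0 a previous position farther from 0 than v is out of reach. *)
pose r := (if j is j'.+1 then d ^ j' else 0)%N.
have stepK b k : (nwalk n (v - unit_step b k) <= outward v b k * (K * d ^ j) + K * r)%N.
  have := norm1_sub_step v b k; case: ifP => _ Ev.
    by rewrite mul1n (leq_trans _ (leq_addr _ _))// IH //; lia.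
  rewrite mul0n add0n {}/r; case: j nvj => [|j] nvj; last by apply: IH; lia.
  by rewrite nwalk_far //; lia.
rewrite /= factS -/K.
apply: (@leq_trans (\sum_(k < d) ((outward v false k + outward v true k) * (K * d ^ j)
                      + 2 * (K * r)))%N).
  apply: leq_sum => k _.
  by rewrite mulnDl mul2n -addnn addnACA leq_add.
rewrite big_split /= -big_distrl /= sum_nat_const card_ord.
have rd : (d * r <= d ^ j)%N by rewrite /r; case: (j) => [|i]; rewrite ?muln0// expnS.
have := sum_outward_le v; move: (\sum_(k < d) _)%N => s sv.
apply: (@leq_trans (n.+1 * (K * d ^ j) + 2 * (K * d ^ j))%N); last first.
  by rewrite -mulnDl addn2 mulnA.
apply: leq_add; first by rewrite leq_mul2r (leq_trans sv near) orbT.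
by rewrite mulnCA leq_mul2l mulnCA leq_mul2l rd orbT.
Qed.

Lemma nwalk_prepend_le (d m n B : nat) : (forall v : 'rV[int]_d, nwalk m v <= B)%N ->
  forall v : 'rV[int]_d, (nwalk (n + m) v <= (2 * d) ^ n * B)%N.
Proof.
move=> mB; elim: n => [|n IH] v; first by rewrite mul1n.
rewrite /=; apply: (@leq_trans (\sum_(k < d) ((2 * d) ^ n * B + (2 * d) ^ n * B))%N).
  by apply: leq_sum => k _; rewrite leq_add.
by rewrite sum_nat_const card_ord expnS addnn -mul2n !mulnA (mulnC d).
Qed.

(** * One-dimensional walks *)

(** The number of sequences of [m] signs with sum [a]. *)
Fixpoint nsign (m : nat) (a : int) : nat :=
  if m is m'.+1 then (nsign m' (a - 1) + nsign m' (a + 1))%N else (a == 0).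

Lemma nsignE (m : nat) (a : int) :
  nsign m a = if a + m%:Z is Posz x then (if odd x then 0 else 'C(m, x./2))%N else 0%N.
Proof.
elim: m a => [|m IH] a /=.
  rewrite addr0; case: a => [x|x] //; rewrite bin0n; case: x => [|[|x]] //=; rewrite ?if_same //.
rewrite !IH.
have -> : a - 1 + m%:Z = a + m.+1%:Z - 2 by lia.
have -> : a + 1 + m%:Z = a + m.+1%:Z by lia.
case: (a + m.+1%:Z) => [[|[|x]]|x] //=.
- by rewrite !bin0.
- rewrite add0n subSS subSS subn0 negbK.
  by case: odd => //=; rewrite binS addnC.
Qed.

Lemma bin_central_max (m j : nat) : ('C(m, j) <= 'C(m, m./2))%N.
Proof.
have up i : (i < m./2)%N -> ('C(m, i) <= 'C(m, i.+1))%N.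
  move=> im; rewrite -(leq_pmul2l (ltn0Sn i)) mul_bin_left leq_mul2r; lia.
have below i : (i <= m./2)%N -> ('C(m, i) <= 'C(m, m./2))%N.
  move=> im; rewrite -(subKn im); elim: (m./2 - i)%N => [|k IH]; first by rewrite subn0.
  have [km|mk] := ltnP k (m./2); last first.
    by have -> : (m./2 - k.+1 = m./2 - k)%N by lia.
  apply: leq_trans IH; rewrite (_ : (m./2 - k = (m./2 - k.+1).+1)%N); last lia.
  by apply: up; lia.
have [jm|mj] := leqP j m./2; first exact: below.
have [jm'|mj'] := leqP j m; last by rewrite bin_small.
rewrite -bin_sub //; apply: below; lia.
Qed.

(** For even [m] the ratio of consecutive terms is
    [(2a+1)(2a+3) / (a+1)^2 <= 4]; an odd central coefficient is half of the next
    even one. *)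
Lemma bin_central_sqr (m : nat) : ('C(m, m./2) ^ 2 * m.+1 <= 4 ^ m)%N.
Proof.
have even a : ('C(a.*2, a) ^ 2 * a.*2.+1 <= 16 ^ a)%N.
  elim: a => [//|a IH].
  have Ebin : (a.+1 * 'C(a.+1.*2, a.+1) = 2 * a.*2.+1 * 'C(a.*2, a))%N.
    rewrite doubleS -mul_bin_diag /= -mulnA (mul_bin_down a.*2.+1 a).
    by rewrite (_ : (a.*2.+1 - a = a.+1)%N) ?mulnA; [congr (_ * _)%N|]; lia.
  rewrite -(@leq_pmul2l (a.+1 ^ 2)) ?expn_gt0 //.
  rewrite mulnA -expnMn Ebin (expnS 16).
  move: ('C(a.*2, a)) (16 ^ a)%N IH => c p IH.
  have : (4 * a.*2.+1 * a.+1.*2.+1 * (c ^ 2 * a.*2.+1) <= 16 * a.+1 ^ 2 * p)%N.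
    by apply: leq_mul => //; nia.
  by move: (a.*2.+1) (a.+1.*2.+1) (a.+1) => x y z; rewrite -!mulnn; lia.
have := odd_double_half m; move: (m./2) => a; case: (odd m) => <-.
  have E : ('C(a.+1.*2, a.+1) = 2 * 'C(a.*2.+1, a))%N.
    rewrite doubleS binS -(@bin_sub _ a.+1); last lia.
    by rewrite (_ : (a.*2.+1 - a.+1 = a)%N) ?mul2n ?addnn //; lia.
  have := even a.+1; rewrite E expnMn -(@leq_pmul2l 4) // add1n (expnS 4) (expnS 16).
  have -> : (16 ^ a = 4 ^ a.*2)%N by rewrite -muln2 mulnC expnM.
  move: ('C(a.*2.+1, a) ^ 2)%N (4 ^ a.*2)%N => c p; lia.
by have := even a; rewrite add0n -[X in (_ <= X ^ a)%N]/(4 ^ 2)%N -expnM mul2n.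
Qed.

Lemma nsign_sqr (m : nat) (a : int) : (nsign m a ^ 2 * m.+1 <= 4 ^ m)%N.
Proof.
apply: leq_trans (bin_central_sqr m); rewrite leq_mul2r leq_exp2r // orFb nsignE.
by case: (a + m%:Z) => // x; case: ifP => // _; exact: bin_central_max.
Qed.

(** * Counting lattice walks: many steps *)

(** The sum of [F] over the words of length [n].  A walk in [Z^d] will be split
    into the word of the coordinates that move and, for each coordinate, a
    sequence of signs. *)
Fixpoint sum_words (R : realFieldType) (T : finType) (n : nat) (F : seq T -> R) : R :=
  if n is n'.+1 then \sum_(k : T) sum_words n' (fun w => F (k :: w)) else F [::].

Lemma le_sum_words (R : realFieldType) (T : finType) (n : nat) (F G : seq T -> R) :
  (forall w, size w = n -> F w <= G w) -> sum_words n F <= sum_words n G.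
Proof.
elim: n F G => [|n IH] F G FG; first exact: FG.
by apply: ler_sum => k _; apply: IH => w wn; apply: FG; rewrite /= wn.
Qed.

Lemma eq_sum_words (R : realFieldType) (T : finType) (n : nat) (F G : seq T -> R) :
  F =1 G -> sum_words n F = sum_words n G.
Proof. by move=> /funext ->. Qed.

Lemma sum_wordsD (R : realFieldType) (T : finType) (n : nat) (F G : seq T -> R) :
  sum_words n (fun w => F w + G w) = sum_words n F + sum_words n G.
Proof.
elim: n F G => [//|n IH] F G /=; rewrite -big_split.
by apply: eq_bigr => k _; exact: (IH (fun w => F (k :: w)) (fun w => G (k :: w))).
Qed.

Lemma sum_wordsZ (R : realFieldType) (T : finType) (n : nat) (a : R) (F : seq T -> R) :
  sum_words n (fun w => a * F w) = a * sum_words n F.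
Proof.
elim: n F => [//|n IH] F /=; rewrite big_distrr.
by apply: eq_bigr => k _; rewrite (IH (fun w => F (k :: w))).
Qed.

Lemma sum_words_sum (R : realFieldType) (T I : finType) (n : nat) (F : I -> seq T -> R) :
  sum_words n (fun w => \sum_(i : I) F i w) = \sum_(i : I) sum_words n (F i).
Proof.
elim: n F => [//|n IH] F /=; rewrite exchange_big.
by apply: eq_bigr => k _; rewrite (IH (fun i w => F i (k :: w))).
Qed.

(** The binomial distribution of the number of occurrences of a letter in a
    uniform random word, without the normalisation by [#|T| ^ n]. *)
Lemma sum_words_count (R : realFieldType) (T : finType) (n : nat) (k : T) (psi : nat -> R) :
  sum_words n (fun w => psi (count_mem k w)) =
  \sum_(m < n.+1) ('C(n, m) * #|T|.-1 ^ (n - m))%:R * psi m.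
Proof.
elim: n psi => [|n IH] psi; first by rewrite big_ord1 /= mul1r.
rewrite /= (bigD1 k) //= eqxx.
under eq_bigr => l /negPf lk do under eq_sum_words => w do rewrite lk add0n.
rewrite sumr_const IH (eq_card (B := predC1 k)) // cardC1 -mulr_natl.
rewrite (IH (fun m => psi (1 + m)%N)) [X in _ = X]big_ord_recl [X in _ + _ * X]big_ord_recl.
rewrite /= !bin0 !mul1n !subn0 mulrDr mulrA -natrM -expnS addrCA; congr (_ + _).
rewrite [in RHS]big_ord_recr [X in X + _]big_ord_recr /= big_distrr /= addrAC -big_split /=.
congr (_ + _); last by rewrite /bump /= !add1n !binn !subnn.
apply: eq_bigr => i _; rewrite /bump /= !add1n subSS.
have -> : (n - i = (n - i.+1).+1)%N by have := ltn_ord i; lia.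
rewrite binS mulnDl natrD mulrDl addrC; congr (_ + _).
by rewrite mulrA -natrM mulnCA expnS.
Qed.

(** The number of walks to [v] whose successive steps are along the coordinates
    listed in [w]: the signs used by different coordinates are independent. *)
Definition word_walks (d : nat) (w : seq 'I_d) (v : 'rV[int]_d) : nat :=
  (\prod_(k < d) nsign (count_mem k w) (v 0%R k))%N.

Lemma word_walks_cons (d : nat) (k : 'I_d) (w : seq 'I_d) (v : 'rV[int]_d) :
  word_walks (k :: w) v =
  (word_walks w (v - unit_step false k) + word_walks w (v - unit_step true k))%N.
Proof.
have split_k w' u : word_walks w' u = (nsign (count_mem k w') (u 0%R k) *
    \prod_(l < d | l != k) nsign (count_mem l w') (u 0%R l))%N.
  by rewrite /word_walks (bigD1 k).
rewrite !split_k.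
have rest b : (\prod_(l < d | l != k) nsign (count_mem l w) ((v - unit_step b k)%R 0%R l) =
   \prod_(l < d | l != k) nsign (count_mem l (k :: w)) (v 0%R l))%N.
  apply: eq_bigr => l /negPf lk /=.
  by rewrite mxE [in X in _ + X]mxE unit_stepE (eq_sym k) lk subr0 add0n.
rewrite !rest -mulnDl /= eqxx /=; congr (_ * _)%N.
by rewrite !mxE !eqxx !mulr1 expr0 expr1 opprK.
Qed.

Lemma nwalk_words (R : realFieldType) (d n : nat) (v : 'rV[int]_d) :
  (nwalk n v)%:R = sum_words n (fun w => (word_walks w v)%:R : R).
Proof.
elim: n v => [|n IH] v.
  rewrite /= /word_walks /=; congr _%:R; case: eqP => [->|v0].
    by rewrite big1 // => k _; rewrite mxE.
  have [k vk] : exists k, v 0 k != 0.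
    apply/existsP; apply: contra_notT v0 => /existsPn v0.
    by apply/rowP => k; rewrite mxE; apply/eqP/negPn/v0.
  by rewrite (bigD1 k) //= (negPf vk).
rewrite /= natr_sum; apply: eq_bigr => k _.
rewrite natrD !IH -sum_wordsD; apply: eq_sum_words => w.
by rewrite word_walks_cons natrD.
Qed.

Lemma sum_count_mem (T : finType) (w : seq T) :
  (\sum_(k : T) count_mem k w = size w)%N.
Proof.
elim: w => [|l w IH] /=; first by rewrite big1.
rewrite big_split /= IH -add1n; congr (_ + _)%N.
by rewrite (bigD1 l) //= eqxx big1 ?addn0 // => k /negPf; rewrite eq_sym => ->.
Qed.

(** Each factor [beta k] is a probability with square at most
    [1 / (m k + 1)], so the product of all of them is at most the [2 r]-th power
    of the largest one; the sum over [k] removes the dependence on the maximiser. *)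
Lemma word_walks_le (R : realFieldType) (d r : nat) (w : seq 'I_d) (v : 'rV[int]_d) :
  (0 < d)%N -> (2 * r <= d)%N ->
  (word_walks w v)%:R <=
  2 ^+ size w * \sum_(k < d) ((count_mem k w).+1%:R ^- r) :> R.
Proof.
move=> d0 rd.
pose m k := count_mem k w.
pose beta k : R := (nsign (m k) (v 0 k))%:R / 2 ^+ m k.
have beta_ge0 k : 0 <= beta k by rewrite divr_ge0 // exprn_ge0.
have beta2 k : beta k ^+ 2 <= (m k).+1%:R^-1.
  rewrite expr_div_n -exprM mulnC exprM -[X in X ^+ m k](natrM _ 2 2).
  rewrite ler_pdivrMr ?exprn_gt0 // mulrC ler_pdivlMr // -!natrX -natrM ler_nat.
  exact: nsign_sqr.
have beta_le1 k : beta k <= 1.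
  by rewrite -(@expr_le1 _ 2) // (le_trans (beta2 k)) // invf_le1 ?ltr0n // ler1n.
have -> : (word_walks w v)%:R = 2 ^+ size w * \prod_(k < d) beta k :> R.
  rewrite /word_walks natr_prod -sum_count_mem -prodrXr -big_split /=.
  by apply: eq_bigr => k _; rewrite mulrC divfK // expf_neq0.
rewrite ler_pM2l ?exprn_gt0 //.
case: (@Order.TotalTheory.arg_maxP _ _ _ (Ordinal d0) xpredT beta isT) => k _ kmax.
apply: (@le_trans _ _ (beta k ^+ d)).
  rewrite -[X in _ ^+ X]card_ord -prodr_const; apply: ler_prod => l _.
  by rewrite beta_ge0 /=; exact: kmax.
apply: (@le_trans _ _ (beta k ^+ (2 * r))).
  by apply: ler_wiXn2l.
apply: (@le_trans _ _ ((m k).+1%:R ^- r)).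
  by rewrite exprM -exprVn lerXn2r ?nnegrE ?exprn_ge0 // invr_ge0.
rewrite (bigD1 k) //= lerDl sumr_ge0 //.
Qed.

Lemma bin_shift_le (n m r : nat) :
  (n ^ r * 'C(n, m) <= r`! * m.+1 ^ r * 'C(n + r, m + r))%N.
Proof.
elim: r => [|r IH]; first by rewrite !addn0.
rewrite !addnS expnS -mulnA; apply: leq_trans (leq_mul (leqnn n) IH) _.
rewrite mulnCA; apply: (@leq_trans (r`! * m.+1 ^ r * ((n + r).+1 * 'C(n + r, m + r)))).
  by rewrite leq_mul2l leq_mul2r; apply/orP; right; apply/orP; right; lia.
rewrite (mul_bin_diag (n + r).+1 (m + r)) factS expnS.
have -> : (r.+1 * r`! * (m.+1 * m.+1 ^ r) * 'C((n + r).+1, (m + r).+1) =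
           r`! * m.+1 ^ r * (r.+1 * m.+1 * 'C((n + r).+1, (m + r).+1)))%N by lia.
by rewrite leq_mul2l leq_mul2r; apply/orP; right; apply/orP; right; nia.
Qed.

(** The factor [(m + 1)^(-r)] turns a binomial coefficient ['C(n, m)] into at most
    a constant times ['C(n + r, m + r) / n^r], and these sum up by the binomial
    theorem. *)
Lemma sum_words_inv_count (R : realFieldType) (T : finType) (n r : nat) (k : T) :
  (0 < n)%N ->
  sum_words n (fun w => (count_mem k w).+1%:R ^- r : R) <=
  (r`! * #|T| ^ (n + r))%:R / n%:R ^+ r.
Proof.
move=> n0; rewrite (sum_words_count n k (fun m => m.+1%:R ^- r)).
have T0 : (0 < #|T|)%N by apply/card_gt0P; exists k.
rewrite ler_pdivlMr ?exprn_gt0 ?ltr0n // big_distrl /=.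
apply: (@le_trans _ _ (\sum_(m < n.+1) (r`! * ('C(n + r, m + r) * #|T|.-1 ^ (n - m)))%:R)).
  apply: ler_sum => m _.
  rewrite mulrAC ler_pdivrMr ?exprn_gt0 ?ltr0n // -!natrX -!natrM ler_nat.
  have := leq_mul (bin_shift_le n m r) (leqnn (#|T|.-1 ^ (n - m))).
  move: (n ^ r)%N (m.+1 ^ r)%N (#|T|.-1 ^ (n - m))%N 'C(n, m) 'C(n + r, m + r) (r`!).
  by move=> *; lia.
rewrite -natr_sum ler_nat -big_distrr /= leq_mul2l; apply/orP; right.
rewrite -[X in (_ <= X ^ _)%N](prednK T0) -(addn1 #|T|.-1) expnDn.
rewrite -(big_mkord xpredT (fun m => 'C(n + r, m + r) * #|T|.-1 ^ (n - m))%N).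
rewrite -(big_mkord xpredT (fun i => 'C(n + r, i) * (#|T|.-1 ^ (n + r - i) * 1 ^ i))%N).
rewrite (@big_cat_nat _ _ _ r 0 (n + r).+1) //=; last lia.
apply: leq_trans (leq_addl _ _).
rewrite -[X in (_ <= \sum_(X <= i < _) _)%N](add0n r) big_addn.
rewrite (_ : ((n + r).+1 - r = n.+1)%N); last lia.
by apply: leq_sum => m _; rewrite exp1n muln1 subnDr.
Qed.

Lemma nwalk_tail (R : realFieldType) (d r n : nat) (v : 'rV[int]_d) :
  (0 < d)%N -> (2 * r <= d)%N -> (0 < n)%N ->
  (nwalk n v)%:R / (2 * d)%:R ^+ n <= (r`! * d ^ r.+1)%:R / n%:R ^+ r :> R.
Proof.
move=> d0 rd n0; rewrite ler_pdivrMr ?exprn_gt0 ?ltr0n ?muln_gt0 //.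
rewrite (nwalk_words R n v).
apply: (@le_trans _ _ (sum_words n (fun w : seq 'I_d =>
   2 ^+ n * \sum_(k < d) ((count_mem k w).+1%:R ^- r)) : R)).
  by apply: le_sum_words => w <-; exact: word_walks_le.
rewrite sum_wordsZ sum_words_sum.
apply: (@le_trans _ _ (2 ^+ n * \sum_(k < d) ((r`! * d ^ (n + r))%:R / n%:R ^+ r))).
  rewrite ler_pM2l ?exprn_gt0 //; apply: ler_sum => k _.
  by have := sum_words_inv_count R r k n0; rewrite card_ord.
rewrite sumr_const card_ord -[X in _ * X]mulr_natl (natrM _ 2 d) exprMn.
rewrite (natrM _ r`! (d ^ (n + r))) (natrM _ r`! (d ^ r.+1)) !natrX exprD exprS.
rewrite le_eqVlt; apply/orP; left; apply/eqP; ring.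
Qed.

(** The bound [nwalk_tail] with [r = 4] is [24 d^5 / n^4], which suffices as soon
    as [n > d^6].  Up to [d^6] it is enough to have [d^(-19)], the order that
    [nwalk_fact] gives after [38] steps, since [d * (d^6)^3 = d^19].  The times
    below [38] only need the order [1 / d] of the first step. *)
Lemma nwalk_decay (R : realFieldType) :
  exists2 C : R, 0 <= C & forall (d n : nat) (v : 'rV[int]_d),
    (8 <= d)%N -> (0 < n)%N ->
    (nwalk n v)%:R / (2 * d)%:R ^+ n <= C / (d%:R * n%:R ^+ 3).
Proof.
(* A variable in place of 40! keeps its unary numeral from being computed. *)
have [f fE] : exists f, f = 40`! by exists 40`!.
have f40 : 0 <= f%:R :> R by exact: ler0n.
have [c cE] : exists c, c = (3 * 38 ^ 3)%N by eexists.
have c38 : 0 <= c%:R :> R by exact: ler0n.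
exists (c%:R + f%:R + 24) => [|d n v d8 n0]; first by move: f40 c38; lra.
have d0 : (0 < d)%N by exact: leq_trans d8.
have dR : 0 < d%:R :> R by rewrite ltr0n.
have nR : 0 < n%:R :> R by rewrite ltr0n.
have from_start m B : (m <= n)%N -> (forall u : 'rV[int]_d, nwalk m u <= B)%N ->
    (nwalk n v)%:R / (2 * d)%:R ^+ n <= B%:R / (2 * d)%:R ^+ m :> R.
  move=> mn mB; have := nwalk_prepend_le (n - m) mB v; rewrite subnK // => le_nm.
  rewrite ler_pdivrMr ?exprn_gt0 ?ltr0n ?muln_gt0 // mulrAC ler_pdivlMr; last first.
    by rewrite exprn_gt0 ?ltr0n ?muln_gt0.
  rewrite -!natrX -!natrM ler_nat.
  rewrite -[in X in (_ <= X)%N](subnK mn) expnD.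
  by apply: leq_trans (leq_mul le_nm (leqnn _)) _; rewrite mulnA (mulnC B).
have le_num (a b : R) : a <= b -> a / (d%:R * n%:R ^+ 3) <= b / (d%:R * n%:R ^+ 3).
  by move=> ab; rewrite ler_wpM2r // invr_ge0 mulr_ge0 ?exprn_ge0 ?ler0n.
have [small|n38] := ltnP n 38.
  apply: (@le_trans _ _ (c%:R / (d%:R * n%:R ^+ 3))); last first.
    by apply: le_num; move: f40 c38; lra.
  have walk1 (u : 'rV[int]_d) : (nwalk 1 u <= 3 * 2)%N.
    by have := @nwalk_fact d 1 0 u d0; rewrite expn0 muln1; apply; lia.
  apply: le_trans (from_start 1%N (3 * 2)%N n0 walk1) _.
  rewrite expr1 ler_pdivrMr ?ltr0n ?muln_gt0 //.
  rewrite mulrAC ler_pdivlMr ?mulr_gt0 ?exprn_gt0 //.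
  rewrite -!natrX -!natrM ler_nat.
  rewrite cE; have : (n ^ 3 <= 38 ^ 3)%N by rewrite leq_exp2r // ltnW.
  by move: (n ^ 3)%N (38 ^ 3)%N => x y xy; nia.
have [mid|large] := leqP n (d ^ 6).
  apply: (@le_trans _ _ (f%:R / (d%:R * n%:R ^+ 3))); last first.
    by apply: le_num; move: f40 c38; lra.
  have walk38 (u : 'rV[int]_d) : (nwalk 38 u <= f * d ^ 19)%N.
    by rewrite fE; apply: (@nwalk_fact d 38 19 u d0); clear; lia.
  apply: le_trans (from_start 38%N (f * d ^ 19)%N n38 walk38) _.
  rewrite natrM -mulrA ler_wpM2l // natrX.
  have pos38 : 0 < (2 * d)%:R ^+ 38 :> R by rewrite exprn_gt0 // ltr0n muln_gt0.
  rewrite ler_pdivrMr // mulrC ler_pdivlMr ?mulr_gt0 ?exprn_gt0 //.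
  rewrite -!natrX -!natrM ler_nat.
  apply: (@leq_trans (d ^ 19 * (d * (d ^ 6) ^ 3))%N).
    by rewrite leq_mul2l leq_mul2l leq_exp2r // mid !orbT.
  by rewrite -expnM -expnS -expnD leq_exp2r // leq_pmull.
apply: (@le_trans _ _ (24 / (d%:R * n%:R ^+ 3))); last first.
  by apply: le_num; move: f40 c38; lra.
apply: le_trans (nwalk_tail R v d0 (r := 4) d8 n0) _.
rewrite ler_pdivrMr ?exprn_gt0 // mulrAC ler_pdivlMr ?mulr_gt0 ?exprn_gt0 //.
rewrite -!natrX -!natrM ler_nat (_ : 4`! = 24)%N // -mulnA leq_mul2l /=.
rewrite mulnA -expnSr [leqRHS]expnS leq_mul2r ltnW ?orbT //.
Qed.

(** * The law of the simple random walk *)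

Lemma fsum_setT (R : realType) (I : finType) (u : I -> \bar R) :
  (\sum_(i \in [set: I]) u i = \sum_(i : I) u i)%E.
Proof.
rewrite (fsbig_seq _ _ (index_enum_uniq I)); congr (\sum_(i \in _) _)%E.
by apply/seteqP; split => i //= _; rewrite mem_index_enum.
Qed.

Lemma le_prob_bigcup (R : realType) (disp : measure_display)
    (Omega : measurableType disp) (P : probability Omega R) (I : finType)
    (A : set Omega) (F : I -> set Omega) :
  measurable A -> (forall i, measurable (F i)) -> A `<=` \bigcup_i F i ->
  (P A <= \sum_(i : I) P (F i))%E.
Proof.
move=> mA mF AF; rewrite -fsum_setT; by apply: content_sub_fsum => //; exact: finite_finset.
Qed.

(** The union bound for a cover that may miss a null set. *)
Lemma le_prob_bigcup_ae (R : realType) (disp : measure_display)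
    (Omega : measurableType disp) (P : probability Omega R) (I : finType)
    (A N : set Omega) (F : I -> set Omega) :
  measurable A -> measurable N -> P N = 0%E -> (forall i, measurable (F i)) ->
  A `\` N `<=` \bigcup_i F i -> (P A <= \sum_(i : I) P (F i))%E.
Proof.
move=> mA mN N0 mF AF; rewrite -(setUIDK A N).
apply: le_trans (measureU2 _ (measurableI _ _ mA mN) (measurableD mA mN)) _.
rewrite -[leRHS]add0e; apply: leeD; last first.
  by apply: le_prob_bigcup => //; exact: measurableD.
by rewrite -N0; apply: le_measure; rewrite ?inE //; exact: measurableI.
Qed.

Lemma unit_step_inj (d : nat) (b b' : bool) (k k' : 'I_d) :
  unit_step b k = unit_step b' k' -> (b, k) = (b', k').
Proof.
move=> /rowP /(_ k); rewrite !unit_stepE eqxx.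
by case: eqP => [<-|_]; case: b; case: b'.
Qed.

Lemma walk_measurable (R : realType) (disp : measure_display)
    (Omega : measurableType disp) (P : probability Omega R) (d : nat)
    (X : nat -> Omega -> 'rV[int]_d) (n : nat) :
  simple_random_walk P X -> discrete_RV (X n).
Proof.
move=> [X0 Xinc _ _]; elim: n => [|n IH] A.
  have [A0|nA0] := pselect (A 0).
    rewrite (_ : _ @^-1` _ = setT); first exact: measurableT.
    by apply/seteqP; split => w //= _; rewrite X0.
  rewrite (_ : _ @^-1` _ = set0); first exact: measurable0.
  by apply/seteqP; split => w //=; rewrite X0.
rewrite (_ : _ @^-1` _ = \bigcup_(u : 'rV[int]_d)
   ((increment X n @^-1` [set u]) `&` (X n @^-1` [set x | A (x + u)]))).
  apply: countable_bigcupT_measurable; first exact: countableP.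
  by move=> u; apply: measurableI; [exact: Xinc|exact: IH].
apply/seteqP; split => w /=.
  by move=> Aw; exists (increment X n w) => //; split => //=; rewrite /increment addrC subrK.
by move=> [u _ [/= <-]]; rewrite /increment addrC subrK.
Qed.

Definition off_lattice_step (Omega : Type) (d : nat) (X : nat -> Omega -> 'rV[int]_d)
    (n : nat) : set Omega :=
  [set w | forall b k, increment X n w <> unit_step b k].

Lemma measurable_off_lattice_step (R : realType) (disp : measure_display)
    (Omega : measurableType disp) (P : probability Omega R) (d : nat)
    (X : nat -> Omega -> 'rV[int]_d) (n : nat) :
  simple_random_walk P X -> measurable (off_lattice_step X n).
Proof. by move=> [_ Xinc _ _]; apply: (Xinc n [set u | forall b k, u <> unit_step b k]). Qed.

Lemma prob_off_lattice_step (R : realType) (disp : measure_display)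
    (Omega : measurableType disp) (P : probability Omega R) (d : nat)
    (X : nat -> Omega -> 'rV[int]_d) (n : nat) :
  (0 < d)%N -> simple_random_walk P X -> P (off_lattice_step X n) = 0%E.
Proof.
move=> d0 [_ Xinc Xunif _].
pose F (s : bool * 'I_d) := [set w | increment X n w = unit_step s.1 s.2].
have mF s : measurable (F s) by apply: (Xinc n [set unit_step s.1 s.2]).
have -> : off_lattice_step X n = ~` \bigcup_s F s.
  apply/seteqP; split => w /=; first by move=> off [[b k] _]; exact: off.
  by move=> off b k wbk; apply: off; exists (b, k).
rewrite probability_setC; last first.
  by apply: fin_bigcup_measurable => //; exact: finite_finset.
rewrite measure_fin_bigcup //; last 2 first.
  exact: finite_finset.
  move=> [b k] [b' k'] _ _ [w [/= wbk wbk']].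
  by apply: unit_step_inj; rewrite -wbk -wbk'.
rewrite fsum_setT (eq_bigr (fun=> ((2 * d)%:R^-1)%:E)); last by move=> s _; exact: Xunif.
rewrite sumEFin sumr_const card_prod card_bool card_ord -(mulr_natl (_^-1)) mulfV ?subee //.
by rewrite pnatr_eq0 muln_eq0 /= -lt0n.
Qed.

(** A step is coded by its sign and its coordinate, as in [unit_step].  The default
    value of [nth] is never read. *)
Definition next_steps (Omega : Type) (d : nat) (X : nat -> Omega -> 'rV[int]_d)
    (n : nat) (t : seq (bool * 'I_d)) : set Omega :=
  [set w | forall i, (i < size t)%N ->
     increment X (n + i) w = nth 0 [seq unit_step s.1 s.2 | s <- t] i].

Lemma next_steps_cons (Omega : Type) (d : nat) (X : nat -> Omega -> 'rV[int]_d)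
    (n : nat) (s : bool * 'I_d) (t : seq (bool * 'I_d)) (w : Omega) :
  next_steps X n (s :: t) w <->
  increment X n w = unit_step s.1 s.2 /\ next_steps X n.+1 t w.
Proof.
split=> [st|[ws wt] [|i] /= it]; last 2 first.
- by rewrite addn0.
- by rewrite addnS -addSn; exact: wt.
- by split; [have := st 0%N isT; rewrite addn0|move=> i it; have := st i.+1 it; rewrite addnS].
Qed.

Lemma measurable_next_steps (R : realType) (disp : measure_display)
    (Omega : measurableType disp) (P : probability Omega R) (d : nat)
    (X : nat -> Omega -> 'rV[int]_d) (n : nat) (t : seq (bool * 'I_d)) :
  simple_random_walk P X -> measurable (next_steps X n t).
Proof.
move=> [_ Xinc _ _]; elim: t n => [|s t IH] n.
  by rewrite (_ : next_steps _ _ _ = setT) //; apply/seteqP; split.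
rewrite (_ : next_steps _ _ _ =
  increment X n @^-1` [set unit_step s.1 s.2] `&` next_steps X n.+1 t).
  by apply: measurableI; [exact: Xinc|exact: IH].
by apply/seteqP; split => w /next_steps_cons.
Qed.

Lemma prob_first_steps (R : realType) (disp : measure_display)
    (Omega : measurableType disp) (P : probability Omega R) (d : nat)
    (X : nat -> Omega -> 'rV[int]_d) (t : seq (bool * 'I_d)) :
  simple_random_walk P X ->
  P (next_steps X 0 t) = ((2 * d)%:R ^- size t)%:E.
Proof.
move=> [_ _ Xunif Xindep].
pose u := [seq unit_step s.1 s.2 | s <- t].
have := Xindep [fset k in iota 0 (size t)]%fset (fun k => [set nth 0 u k]).
rewrite (_ : \bigcap_(k in _) _ = next_steps X 0 t); last first.
  apply/seteqP; split => w /= h k; last first.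
    by rewrite /= !inE mem_iota /= add0n; exact: h.
  by move=> kt; apply: (h k); rewrite /= !inE mem_iota.
move=> ->.
rewrite (eq_big_seq (fun=> ((2 * d)%:R^-1)%:E)); last first.
  move=> k; rewrite !inE mem_iota /= add0n => kt.
  have [s us] : exists s : bool * 'I_d, nth 0 u k = unit_step s.1 s.2.
    have : nth 0 u k \in u by rewrite mem_nth // size_map.
    by move=> /mapP[s _ us]; exists s.
  by rewrite us; exact: Xunif.
rewrite prodEFin big_const_seq count_predT -/(#|` _|) card_fseq undup_id ?iota_uniq //.
by rewrite size_iota iter_mulr_1 exprVn.
Qed.

(** Independence is assumed only jointly for the increments, and the position at
    time [n] is not one of them.  Carrying along a prescribed future [t] makes an
    induction on [n] possible: splitting off the last step before the present
    moves it into the future, and at [n = 0] only increments are left. *)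
Lemma prob_walk_next_steps (R : realType) (disp : measure_display)
    (Omega : measurableType disp) (P : probability Omega R) (d : nat)
    (X : nat -> Omega -> 'rV[int]_d) (n : nat) (v : 'rV[int]_d)
    (t : seq (bool * 'I_d)) :
  (0 < d)%N -> simple_random_walk P X ->
  (P (X n @^-1` [set v] `&` next_steps X n t) <=
   ((nwalk n v)%:R / (2 * d)%:R ^+ (n + size t))%:E)%E.
Proof.
move=> d0 srw.
have mX m u s : measurable (X m @^-1` [set u] `&` next_steps X m s).
  by apply: measurableI; [exact: walk_measurable srw _|exact: measurable_next_steps srw].
elim: n v t => [|n IH] v t.
  rewrite /= add0n; case: eqP => [->|v0].
    rewrite mul1r -(prob_first_steps t srw); apply: le_measure; rewrite ?inE //.
    exact: measurable_next_steps srw.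
  rewrite mul0r (_ : _ `&` _ = set0) ?measure0 //.
  by case: srw => X0 _ _ _; apply/seteqP; split => w //= [/=]; rewrite X0 => /esym.
pose F (s : bool * 'I_d) :=
  X n @^-1` [set v - unit_step s.1 s.2] `&` next_steps X n (s :: t).
apply: (@le_trans _ _ (\sum_s P (F s))%E).
  apply: (le_prob_bigcup_ae (mX _ _ _) (measurable_off_lattice_step n srw)
            (prob_off_lattice_step n d0 srw)).
    by move=> s; exact: mX.
  move=> w [[/= Xv wt] on]; have [b [k wbk]] : exists b k, increment X n w = unit_step b k.
    by apply: contra_notP on => on b k wbk; apply: on; exists b, k.
  exists (b, k) => //=; split; last by apply/next_steps_cons.
  by rewrite /= -Xv -wbk /increment opprB addrC subrK.
apply: (@le_trans _ _ (\sum_(s : bool * 'I_d)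
   ((nwalk n (v - unit_step s.1 s.2))%:R / (2 * d)%:R ^+ (n.+1 + size t))%:E)%E).
  by apply: lee_sum => s _; apply: le_trans (IH _ _) _; rewrite /= addnS addSn.
rewrite sumEFin lee_fin -mulr_suml ler_wpM2r ?invr_ge0 ?exprn_ge0 // -natr_sum ler_nat.
rewrite -(pair_bigA _ (fun b k => nwalk n (v - unit_step b k))) /= big_bool /=.
by rewrite addnC -big_split.
Qed.

Lemma prob_walk_le (R : realType) (disp : measure_display)
    (Omega : measurableType disp) (P : probability Omega R) (d : nat)
    (X : nat -> Omega -> 'rV[int]_d) (n : nat) (v : 'rV[int]_d) :
  (0 < d)%N -> simple_random_walk P X ->
  (P (X n @^-1` [set v]) <= ((nwalk n v)%:R / (2 * d)%:R ^+ n)%:E)%E.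
Proof.
move=> d0 srw; have := prob_walk_next_steps n v [::] d0 srw.
by rewrite addn0 (_ : next_steps _ _ _ = setT) ?setIT //; apply/seteqP; split.
Qed.

(** * Geometry of the targets *)

Definition coord_sum (d : nat) (v : 'rV[int]_d) : int := \sum_(k < d) v 0 k.

(** The positions at which the difference walk is at some [e_j - e_i]. *)
Definition target (d : nat) (i : 'I_d) : set 'rV[int]_d :=
  [set v | exists j : 'I_d, coord_diff v = evec d.-1 j - evec d.-1 i].

(** Up to a multiple of [(1, ..., 1)], a point is determined by its successive
    coordinate differences, and those of [1_{k < j}] are [e_j]. *)
Lemma target_shape (d : nat) (i j : 'I_d) (v : 'rV[int]_d) :
  coord_diff v = evec d.-1 j - evec d.-1 i ->
  exists c : int, forall k : 'I_d, v 0 k = c + (k < j)%N%:Z - (k < i)%N%:Z.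
Proof.
case: d i j v => [[]//|d] i j v /rowP vij.
exists (v 0 ord0 - (0 < j)%N%:Z + (0 < i)%N%:Z) => -[k].
elim: k => [|k IH] kd.
  by rewrite (_ : Ordinal kd = ord0); [rewrite /=; lia|exact: val_inj].
have kd' : (k < d)%N by [].
have := vij (Ordinal kd'); rewrite !mxE.
rewrite (_ : coord_fst _ = Ordinal (ltnW kd)); last exact: val_inj.
rewrite (_ : coord_snd _ = Ordinal kd); last exact: val_inj.
rewrite IH /=; set x := v 0 _; set y := v 0 _ => h.
move: h; case: (k.+1 =P j :> nat); case: (k.+1 =P i :> nat); lia.
Qed.

Lemma sum_ltn (d j : nat) : (j <= d)%N -> (\sum_(k < d) (k < j))%N = j.
Proof.
move=> jd; rewrite -(big_mkord xpredT (fun k => nat_of_bool (k < j)%N)).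
rewrite (@big_cat_nat _ _ _ j) //= (eq_big_nat _ _ (F2 := fun=> 1%N)); last first.
  by move=> k /andP[_ ->].
rewrite sum_nat_const_nat muln1 subn0 big_nat big1 ?addn0 // => k /andP[jk _].
by rewrite ltnNge jk.
Qed.

Lemma coord_sum_target (d : nat) (i j : 'I_d) (c : int) (v : 'rV[int]_d) :
  (forall k : 'I_d, v 0 k = c + (k < j)%N%:Z - (k < i)%N%:Z) ->
  coord_sum v = d%:Z * c + j%:Z - i%:Z.
Proof.
have sumZ (l : 'I_d) : \sum_(k < d) ((k < l)%N%:Z : int) = l%:Z.
  rewrite (eq_bigr (fun k : 'I_d => (k < l)%N%:R)); last by move=> k _; rewrite natz.
  by rewrite -natr_sum sum_ltn ?natz // ltnW.
move=> vE; rewrite /coord_sum (eq_bigr _ (fun k _ => vE k)).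
rewrite sumrB big_split /= !sumZ sumr_const card_ord -mulr_natl natz; lia.
Qed.

Lemma target_inj (d : nat) (i : 'I_d) (v v' : 'rV[int]_d) :
  target i v -> target i v' -> coord_sum v = coord_sum v' -> v = v'.
Proof.
move=> [j /target_shape[c vE]] [j' /target_shape[c' vE']].
rewrite (coord_sum_target vE) (coord_sum_target vE') => e.
have jd := ltn_ord j; have jd' := ltn_ord j'.
have cc : c = c' by nia.
have jj : j = j' :> nat by nia.
by apply/rowP => k; rewrite vE vE' cc jj.
Qed.

(** * The union bound *)

Lemma prob_coord_sum_gt (R : realType) (disp : measure_display)
    (Omega : measurableType disp) (P : probability Omega R) (d : nat)
    (X : nat -> Omega -> 'rV[int]_d) (n : nat) :
  (0 < d)%N -> simple_random_walk P X ->
  P (X n @^-1` [set v | (n < `|coord_sum v|)%N]) = 0%E.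
Proof.
move=> d0 srw; have mX m A := walk_measurable m srw A.
elim: n => [|n IH].
  rewrite (_ : _ @^-1` _ = set0) ?measure0 //; apply/seteqP; split => w //=.
  by case: srw => -> _ _ _; rewrite /coord_sum big1 // => k _; rewrite mxE.
apply/eqP; rewrite eq_le measure_ge0 andbT.
(* The coordinate sum can exceed n + 1 only if it exceeded n one step before: a
   cover by one null event, up to the null event of an irregular step. *)
have -> : 0%E = (\sum_(s : 'I_1) P (X n @^-1` [set v | (n < `|coord_sum v|)%N]))%E.
  by rewrite big_ord1.
apply: (le_prob_bigcup_ae _ (measurable_off_lattice_step n srw)
          (prob_off_lattice_step n d0 srw)) => //.
move=> w [/= far on]; exists ord0 => //=; rewrite ltnNge; apply/negP => near; apply: on => b k wbk.
have : coord_sum (X n.+1 w) = coord_sum (X n w) + (-1) ^+ b.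
  rewrite /coord_sum -(subrK (X n w) (X n.+1 w)) -/(increment X n w) wbk.
  under eq_bigr => l _ do rewrite mxE unit_stepE.
  by rewrite big_split /= addrC -big_mkcond big_pred1_eq.
by move: far near; case: b {wbk} => /=; rewrite ?expr0 ?expr1; lia.
Qed.

(** The targets in reach at time [n] are indexed by their coordinate sums, the
    [2 n + 1] integers between [-n] and [n]; the index [s] is the sum plus [n]. *)
Lemma prob_target_le (R : realType) (disp : measure_display)
    (Omega : measurableType disp) (P : probability Omega R) (d : nat)
    (X : nat -> Omega -> 'rV[int]_d) (n : nat) (i : 'I_d) (B : R) :
  simple_random_walk P X -> 0 <= B ->
  (forall v, P (X n @^-1` [set v]) <= B%:E)%E ->
  (P (X n @^-1` target i) <= ((2 * n).+1%:R * B)%:E)%E.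
Proof.
move=> srw B0 PB; have mX A := walk_measurable n srw A.
have d0 : (0 < d)%N by exact: leq_trans (ltn_ord i).
pose F (s : 'I_(2 * n).+1) :=
  X n @^-1` (target i `&` [set v | coord_sum v = s%:Z - n%:Z]).
have mF s : measurable (F s) by exact: mX.
apply: (@le_trans _ _ (\sum_s P (F s))%E).
  apply: (le_prob_bigcup_ae _ _ (prob_coord_sum_gt n d0 srw)) => //.
  move=> w [Tw /= /negP]; rewrite -leqNgt => near.
  have sn : (`|(coord_sum (X n w) + n%:Z)%R| < (2 * n).+1)%N by lia.
  by exists (Ordinal sn) => //; split => //=; lia.
apply: (@le_trans _ _ (\sum_(s : 'I_(2 * n).+1) B%:E)%E); last first.
  by rewrite sumEFin sumr_const card_ord mulr_natl.
apply: lee_sum => s _.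
have [[v [Tv vs]]|none] := pselect (exists v, target i v /\ coord_sum v = s%:Z - n%:Z).
  apply: le_trans (PB v); apply: le_measure; rewrite ?inE //.
  by move=> w [Tw ws]; apply: target_inj Tw Tv _; rewrite ws.
rewrite (_ : F s = set0) ?measure0 //; apply/seteqP; split => w //= [Tw ws].
by apply: none; exists (X n w).
Qed.

(** Compare with the telescoping sum of [1 / n - 1 / (n + 1)]. *)
Lemma sum_inv_sqr_le (R : realFieldType) (N : nat) :
  \sum_(n < N) (n.+1%:R ^- 2 : R) <= 2.
Proof.
case: N => [|N]; first by rewrite big_ord0.
suff : \sum_(n < N.+1) (n.+1%:R ^- 2 : R) <= 2 - N.+1%:R^-1.
  by move/le_trans; apply; rewrite gerBl invr_ge0.
elim: N => [|N IH]; first by rewrite big_ord1 expr1n invr1; lra.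
rewrite big_ord_recr /=; apply: le_trans (lerD IH (lexx _)) _.
have N0 : 0 < N.+1%:R :> R by rewrite ltr0n.
rewrite -[N.+2]addn1 natrD; move: (N.+1%:R : R) N0 => x x0.
have x1 : 0 < x + 1 by lra.
rewrite -subr_ge0 (_ : _ - _ = (x * (x + 1) ^+ 2)^-1); first by rewrite invr_ge0; nra.
by field; apply/andP; split; apply: lt0r_neq0.
Qed.

Theorem theoremA3 (R : realType) :
  exists C : R,
    forall (d : nat), (4 <= d)%N ->
    forall (disp : measure_display) (Omega : measurableType disp)
           (P : probability Omega R) (X : nat -> Omega -> 'rV[int]_d),
      simple_random_walk P X ->
      (ereal_sup
         (range (fun i : 'I_d =>
            P [set w : Omega |
                 ereal_inf (range (fun j : 'I_d => hit_time R X i j w)) < +oo]))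
       <= (C / d%:R)%:E)%E.
Proof.
have [D D0 decay] := nwalk_decay R.
exists (8 + 6 * D) => d d4 disp Omega P X srw.
have d0 : (0 < d)%N by exact: leq_trans d4.
have dR : 0 < d%:R :> R by rewrite ltr0n.
have mX n A := walk_measurable n srw A.
apply: ge_ereal_sup => _ [i _ <-].
(* An infimum of hitting times is finite iff some target is hit. *)
have -> : [set w : Omega | (ereal_inf (range (fun j : 'I_d => hit_time R X i j w)) < +oo)%E]
    = \bigcup_n (X n.+1 @^-1` target i).
  apply/seteqP; split => w /=.
    move=> /ereal_inf_lt[_ [j _ <-]] /ereal_inf_lt[_ [n [n0 hit] _] _].
    by exists n.-1 => //; exists j; rewrite prednK.
  move=> [n _ [j hit]]; apply: (@le_lt_trans _ _ (n.+1%:R%:E : \bar R)); last exact: ltry.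
  apply: (@le_trans _ _ (hit_time R X i j w)); first by apply: ereal_inf_lbound; exists j.
  by apply: ereal_inf_lbound; exists n.+1.
have mT n : measurable (X n.+1 @^-1` target i) by exact: mX.
have mU := bigcupT_measurable _ mT.
have [d8|d8] := ltnP d 8.
  apply: le_trans (probability_le1 _ mU) _.
  rewrite lee_fin ler_pdivlMr // mul1r (@le_trans _ _ 8) ?lerDl ?mulr_ge0 //.
  by rewrite ler_nat ltnW.
apply: le_trans (measure_sigma_subadditive _ mT mU (@subset_refl _ _)) _.
apply: lime_le; first by apply: is_cvg_nneseries => n _ _; exact: measure_ge0.
apply: nearW => N; rewrite /eseries /= big_mkord.
apply: (@le_trans _ _ (\sum_(n < N) ((3 * D / d%:R * n.+1%:R ^- 2)%:E))%E).
  apply: lee_sum => n _.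
  pose B : R := D / (d%:R * n.+1%:R ^+ 3).
  have B0 : 0 <= B by rewrite divr_ge0 // mulr_ge0 // ?exprn_ge0.
  apply: (le_trans (prob_target_le (B := B) i srw B0 _)).
    move=> v; apply: le_trans (prob_walk_le n.+1 v d0 srw) _.
    by rewrite lee_fin; exact: decay.
  rewrite lee_fin.
  have nR : 0 < n.+1%:R :> R by rewrite ltr0n.
  have -> : 3 * D / d%:R * n.+1%:R ^- 2 = (3 * n.+1)%:R * B.
    by rewrite /B natrM; field; rewrite !lt0r_neq0.
  by rewrite ler_wpM2r // ler_nat; lia.
rewrite sumEFin lee_fin -mulr_sumr.
apply: (@le_trans _ _ (3 * D / d%:R * 2)).
  by rewrite ler_wpM2l ?sum_inv_sqr_le // divr_ge0 ?mulr_ge0 // ltW.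
rewrite mulrAC ler_wpM2r ?invr_ge0 ?ltW //; lra.
Qed.
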